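(* Let $\Omega$ be the set of odd positive integers and let $S:\Omega\to\Omega$ be the Syracuse function, $S(m)=(3m+1)/2^{e}$, where $2^{e}$ is the highest power of $2$ dividing $3m+1$. Then $S$ is wildly increasing-decreasing; that is, for every finite sequence $V=(v_i)_{i=1}^n$ of positive integers there exists $m\in\Omega$ such that $m$ has increasing-decreasing pattern $V$ with respect to $S$.
   Context: For a function $f:\Omega\to\Omega$ on a set $\Omega$ of positive integers, $f^j$ denotes the $j$th iterate of $f$, with $f^0$ the identity. Let $V=(v_i)_{i=1}^n$ be a finite sequence of positive integers. An integer $m\in\Omega$ has increasing-decreasing pattern $V$ with respect to $f$ if, for every odd $i\in\{1,\ldots,n\}$, $$f^{v_1+\cdots+v_{i-1}}(m)<f^{v_1+\cdots+v_{i-1}+1}(m)<\cdots<f^{v_1+\cdots+v_{i-1}+v_i}(m),$$ and, for every even $i\in\{1,\ldots,n\}$, $$f^{v_1+\cdots+v_{i-1}}(m)>f^{v_1+\cdots+v_{i-1}+1}(m)>\cdots>f^{v_1+\cdots+v_{i-1}+v_i}(m),$$ where the empty sum (for $i=1$) is $0$. The function $f$ is wildly increasing-decreasing if for every finite sequence $V$ of positive integers there exists $m\in\Omega$ having increasing-decreasing pattern $V$ with respect to $f$. *)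

(* Defs.v *)
From mathcomp Require Import all_boot.

Set Implicit Arguments.
Unset Strict Implicit.
Unset Printing Implicit Defensive.

Section Pattern.

Variables (Omega : pred nat) (f : {m : nat | Omega m} -> {m : nat | Omega m}).

(* V = (v_1, ..., v_n): the index i is 1-based, so v_i is [nth 0 V i.-1] and
   v_1 + ... + v_(i-1) is [sumn (take i.-1 V)].  A chain of v_i strict
   inequalities is given by its consecutive comparisons. *)
Definition has_incr_decr_pattern (V : seq nat) (m : {m : nat | Omega m}) : Prop :=
  forall i : nat, 1 <= i <= size V ->
  let s := sumn (take i.-1 V) in
  (odd i -> forall j : nat, j < nth 0 V i.-1 ->
     val (iter (s + j) f m) < val (iter (s + j).+1 f m)) /\
  (~~ odd i -> forall j : nat, j < nth 0 V i.-1 ->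
     val (iter (s + j) f m) > val (iter (s + j).+1 f m)).

Definition wildly_incr_decr : Prop :=
  forall V : seq nat, (forall v : nat, v \in V -> 0 < v) ->
  exists m : {m : nat | Omega m}, has_incr_decr_pattern V m.

End Pattern.

Definition syracuse_nat (m : nat) : nat :=
  (3 * m + 1) %/ 2 ^ logn 2 (3 * m + 1).

Lemma odd_syracuse_nat (m : nat) : odd (syracuse_nat m).
Proof.
have pos : 0 < 3 * m + 1 by rewrite addn1.
rewrite /syracuse_nat.
have [k co_k {1}->] := pfactor_coprime (isT : prime 2) pos.
by rewrite mulnK ?expn_gt0 // -coprime2n.
Qed.

(* [odd 0] is false, so {m | odd m} is the set of odd positive integers. *)
Definition syracuse (m : {m : nat | odd m}) : {m : nat | odd m} :=
  Sub (syracuse_nat (val m)) (odd_syracuse_nat (val m)).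

(* Main.v *)
Require Import Defs.
From mathcomp Require Import all_boot zify.

(* When x = 3y + 2 is odd, x = S(2y + 1) with exponent e = 1, an increase, and
   x = S(8y + 5) with exponent e = 3, a decrease.  The numbers realizing a given
   finite list of comparisons contain an arithmetic progression whose step is
   prime to 3; such a progression meets the class of 2 mod 3, so one more
   comparison can be prescribed in front, and the step is only multiplied by 2
   or 8.  Decreasing with e = 3 rather than e = 2 avoids the fixed point 1. *)

Lemma syracuse_natE (m e x : nat) :
  odd x -> 3 * m + 1 = 2 ^ e * x -> syracuse_nat m = x.
Proof.
move=> odd_x def_x; rewrite /syracuse_nat def_x.
have x_gt0 : 0 < x by case: x odd_x {def_x}.
rewrite lognM ?expn_gt0 // pfactorK // (lognE 2 x) dvdn2 odd_x andbF addn0.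
by rewrite mulKn // expn_gt0.
Qed.

Lemma val_iter_syracuse (k : nat) (m : {m : nat | odd m}) :
  val (iter k syracuse m) = iter k syracuse_nat (val m).
Proof. by elim: k => //= k <-. Qed.

(** Directions are given one step at a time, on plain naturals, so that induction can run on the
    number of steps rather than on the blocks of [V]. *)
Definition follows (up : nat -> bool) (N m : nat) : Prop :=
  forall k, k < N ->
  if up k then iter k syracuse_nat m < iter k.+1 syracuse_nat m
  else iter k.+1 syracuse_nat m < iter k syracuse_nat m.

Lemma followsS (up : nat -> bool) (N m : nat) :
  (if up 0 then m < syracuse_nat m else syracuse_nat m < m) ->
  follows (fun k => up k.+1) N (syracuse_nat m) -> follows up N.+1 m.
Proof.
move=> up0 upS [_|k lt_kN]; first exact: up0.
by have := upS k lt_kN; rewrite -!iterSr.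
Qed.

(** Since [b] is invertible mod 3, the terms for [t] = 0, 1, 2 cover all residues. *)
Lemma progression_meets_2_mod_3 (a b : nat) :
  ~~ (3 %| b) -> exists t y, a + b * t = 3 * y + 2.
Proof.
move=> b3.
have [t t2] : exists t, (a + b * t) %% 3 = 2.
  have [a0|[a1|a2]] : a %% 3 = 0 \/ a %% 3 = 1 \/ a %% 3 = 2 by lia.
  - have [b1|b2] : b %% 3 = 1 \/ b %% 3 = 2 by lia.
    + by exists 2; lia.
    + by exists 1; lia.
  - have [b1|b2] : b %% 3 = 1 \/ b %% 3 = 2 by lia.
    + by exists 1; lia.
    + by exists 2; lia.
  - by exists 0; lia.
by exists t, ((a + b * t) %/ 3); lia.
Qed.

Lemma progression_follows (N : nat) (up : nat -> bool) :
  exists a b, ~~ (3 %| b) /\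
    forall t, odd (a + b * t) /\ follows up N (a + b * t).
Proof.
elim: N up => [|N IHN] up.
  by exists 1, 2; split=> // t; split; [lia | case].
have [a [b [b3 ab]]] := IHN (fun k => up k.+1).
have [t0 [y def_y]] := progression_meets_2_mod_3 a b b3.
(* Every third term stays in the class of 2 mod 3; along these terms [y] advances by [b], so the
   preimages advance by [2 * b] or [8 * b]. *)
have shift t : a + b * (t0 + 3 * t) = 3 * (y + b * t) + 2.
  by rewrite mulnDr addnA def_y; lia.
have E t := ab (t0 + 3 * t).
case up0: (up 0); [exists (2 * y + 1), (2 * b) | exists (8 * y + 5), (8 * b)];
  (split; first lia) => t; have [] := ab (t0 + 3 * t); rewrite shift => odd_x fol.
- have -> : 2 * y + 1 + 2 * b * t = 2 * (y + b * t) + 1 by lia.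
  have def_S : syracuse_nat (2 * (y + b * t) + 1) = 3 * (y + b * t) + 2.
    by apply: (@syracuse_natE _ 1) => //; lia.
  split; first lia.
  by apply: followsS; rewrite def_S // up0; lia.
- have -> : 8 * y + 5 + 8 * b * t = 8 * (y + b * t) + 5 by lia.
  have def_S : syracuse_nat (8 * (y + b * t) + 5) = 3 * (y + b * t) + 2.
    by apply: (@syracuse_natE _ 3) => //; lia.
  split; first lia.
  by apply: followsS; rewrite def_S // up0; lia.
Qed.

Theorem theorem4 : wildly_incr_decr syracuse.
Proof.
move=> V _.
(* [reshape_index V k] is the block containing step [k], counted from 0; the pattern counts blocks
   from 1, hence the negation. *)
pose up k := ~~ odd (reshape_index V k).
have [a [b [_ ab]]] := progression_follows (sumn V) up.
have [odd_m fol] := ab 0.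
exists (Sub (a + b * 0) odd_m) => i /andP[i_gt0 le_iV] /=.
have step j : j < nth 0 V i.-1 ->
  let k := sumn (take i.-1 V) + j in k < sumn V /\ up k = odd i.
  move=> lt_j /=; split.
    rewrite -{2}(cat_take_drop i.-1 V) sumn_cat ltn_add2l.
    rewrite (drop_nth 0) /=; last by rewrite prednK.
    by rewrite (leq_trans lt_j) // leq_addr.
  by rewrite /up [reshape_index V _](flatten_indexKl lt_j) -oddS prednK.
split=> odd_i j lt_j; have [lt_k up_k] := step j lt_j;
  by have := fol _ lt_k; rewrite up_k ?(negPf odd_i) ?odd_i !val_iter_syracuse.
Qed.
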